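(* Let $R$ be an integral domain (not a field) that is finitely stable and an LPI-domain. Assume that every nonzero finitely generated ideal $I$ of $R$ is principal as an ideal of its endomorphism ring $E(I)=(I:I)$, i.e. $I=xE(I)$ for some $x\in I$. Then $R$ has finite character.
   Context: Let $R$ be an integral domain with quotient field $K\neq R$. For a nonzero (fractional) ideal $I$ of $R$, $(I:I)=\{x\in K: xI\subseteq I\}$ and $E(I):=(I:I)$ is its endomorphism ring. An ideal $I$ is locally principal if $IR_M$ is principal for every maximal ideal $M$ of $R$; it is invertible if $I(R:I)=R$, where $(R:I)=\{x\in K: xI\subseteq R\}$. $R$ is an LPI-domain if every locally principal nonzero ideal of $R$ is invertible. A nonzero ideal $I$ is stable if it is invertible as an ideal of the ring $E(I)$; $R$ is finitely stable if every nonzero finitely generated ideal of $R$ is stable. $R$ has finite character if every nonzero element of $R$ lies in only finitely many maximal ideals of $R$. *)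

(* Defs.v *)
From HB Require Import structures.
From mathcomp Require Import all_boot all_order all_algebra.
Set Implicit Arguments. Unset Strict Implicit. Unset Printing Implicit Defensive.
Import GRing.Theory.
Local Open Scope ring_scope.

Section Defs.
Variable R : idomainType.
Local Notation K := {fraction R}.
Local Notation "x %:F" := (@FracField.tofrac R x).

Definition is_ideal (I : R -> Prop) : Prop :=
  [/\ I 0, (forall x y, I x -> I y -> I (x + y)) & (forall r x, I x -> I (r * x))].

Definition nonzero_ideal (I : R -> Prop) : Prop := exists2 x, I x & x != 0.

Definition maximal_ideal (M : R -> Prop) : Prop :=
  [/\ is_ideal M, ~ M 1 &
     forall J : R -> Prop, is_ideal J -> (forall x, M x -> J x) -> ~ J 1 ->
       forall x, J x -> M x].

Definition fin_gen (I : R -> Prop) : Prop :=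
  exists n (g : 'I_n -> R), forall x, I x <-> exists c : 'I_n -> R, x = \sum_(i < n) c i * g i.

Definition set_eqK (A B : K -> Prop) : Prop := forall x, A x <-> B x.

Definition RinK : K -> Prop := fun y => exists a, y = a%:F.
Definition IinK (I : R -> Prop) : K -> Prop := fun y => exists2 a, I a & y = a%:F.

Definition colon (A B : K -> Prop) : K -> Prop := fun x => forall b, B b -> A (x * b).

Definition prodK (A B : K -> Prop) : K -> Prop := fun x =>
  exists n (a b : 'I_n -> K), [/\ forall i, A (a i), forall i, B (b i) &
                                 x = \sum_(i < n) a i * b i].

Definition endo (I : R -> Prop) : K -> Prop := colon (IinK I) (IinK I).

Definition invertible (I : R -> Prop) : Prop :=
  set_eqK (prodK (IinK I) (colon RinK (IinK I))) RinK.

(* I is invertible as an ideal of E(I) *)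
Definition stable (I : R -> Prop) : Prop :=
  set_eqK (prodK (IinK I) (colon (endo I) (IinK I))) (endo I).

Definition localization (M : R -> Prop) : K -> Prop := fun y =>
  exists a s, ~ M s /\ y = a%:F / s%:F.

Definition locally_principal (I : R -> Prop) : Prop :=
  forall M, maximal_ideal M ->
    exists y : K, set_eqK (prodK (IinK I) (localization M))
                          (fun x => exists2 r, localization M r & x = y * r).

Definition LPI_domain : Prop :=
  forall I, is_ideal I -> nonzero_ideal I -> locally_principal I -> invertible I.

Definition finitely_stable : Prop :=
  forall I, is_ideal I -> nonzero_ideal I -> fin_gen I -> stable I.

Definition finite_character : Prop :=
  forall r : R, r != 0 ->
    exists n (Ms : 'I_n -> R -> Prop),
      forall M, maximal_ideal M -> M r -> exists i, forall x, M x <-> Ms i x.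

End Defs.

(* Main.v *)
Require Import Defs.
From HB Require Import structures.
From mathcomp Require Import all_boot all_order all_algebra ring.
From Stdlib Require Import Classical ClassicalEpsilon.
Import GRing.Theory.
Local Open Scope ring_scope.
Set Implicit Arguments. Unset Strict Implicit. Unset Printing Implicit Defensive.

(** If [I = x E(I)] with [x] in [I], then [I^2 = x I], so [x] lies in [I] and
    divides the square of every element of [I].  Hence, if a nonzero [a] lies
    in infinitely many maximal ideals, one can choose greedily nonunits
    [x_0, x_1, ...] dividing [A = a^2], each [x_k] being comaximal with
    [p_k = x_0 ... x_(k-1)]: two distinct maximal ideals containing [a] but not
    [p_k] provide two comaximal candidates, and no maximal ideal contains both,
    so one of them is avoided by infinitely many of the remaining maximal
    ideals.  The union [J] of the chain of principal ideals [(A / p_k)] is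
    locally principal, because a maximal ideal contains at most one [x_k].
    If [J] were invertible it would be finitely generated, so the chain would
    stop, contradicting that the [x_k] are nonunits. *)

(** * Comaximal elements and maximal ideals *)

Section Comaximality.
Variable R : idomainType.
Implicit Types (M N : R -> Prop) (b c x y : R).

Definition divides x y := exists r, y = r * x.

Definition comaximal x y := exists u v, u * x + v * y = 1.

Lemma comaximal_dvd_mul x y (A : R) :
  comaximal x y -> divides x A -> divides y A -> divides (x * y) A.
Proof.
(* Multiply [u * x + v * y = 1] by [A], replacing [A] by [r * y] in the first term and by [q * x] in
   the second. *)
move=> [u [v uv]] [q Aq] [r Ar]; exists (u * r + v * q).
by rewrite -[LHS]mul1r -uv mulrDl {1}Ar Aq; ring.
Qed.

(* [1 = (b + c) ^ 3] lies in [(b ^ 2, c ^ 2)] *)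
Lemma comaximal_of_sqr b c x y :
  b + c = 1 -> divides x (b * b) -> divides y (c * c) -> comaximal x y.
Proof.
move=> bc1 [r br] [s cs].
exists ((b + (c *+ 3)) * r), (((b *+ 3) + c) * s).
rewrite -!mulrA -br -cs -[RHS](expr1n _ 3) -bc1; ring.
Qed.

Lemma maximal_ideal_comaximal M x :
  maximal_ideal M -> ~ M x -> exists r, M (1 - r * x).
Proof.
move=> maxM nMx; have [[M0 MD MM] M1 Mmax] := maxM.
pose J y := exists2 m, M m & exists r, y = m + r * x.
have [[m Mm [r E]]|nJ1] := classic (J 1).
  by exists r; rewrite E addrK.
case: nMx; apply: (Mmax J) => //.
- split.
  + by exists 0 => //; exists 0; rewrite mul0r addr0.
  + move=> _ _ [m Mm [r ->]] [n Mn [s ->]].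
    by exists (m + n); [apply: MD | exists (r + s); ring].
  + move=> r _ [m Mm [s ->]].
    by exists (r * m); [apply: MM | exists (r * s); ring].
- by move=> y My; exists y => //; exists 0; rewrite mul0r addr0.
- by exists 0 => //; exists 1; rewrite mul1r add0r.
Qed.

Lemma maximal_ideal_prime M x y :
  maximal_ideal M -> ~ M x -> ~ M y -> ~ M (x * y).
Proof.
move=> maxM nMx nMy Mxy; have [r Mr] := maximal_ideal_comaximal maxM nMx.
have [[_ MD MM] _ _] := maxM; apply: nMy.
have -> : y = y * (1 - r * x) + r * (x * y) by ring.
by apply: MD; apply: MM.
Qed.

Lemma maximal_ideal_not_comaximal M x y :
  maximal_ideal M -> comaximal x y -> M x -> ~ M y.
Proof.
move=> [[_ MD MM] M1 _] [u [v uv]] Mx My; apply: M1; rewrite -uv.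
by apply: MD; apply: MM.
Qed.

(** An inclusion of [M] in [N] would be an equality by maximality, so some element of [M] is outside
    [N] and thus invertible modulo [N]. *)
Lemma maximal_ideals_separate M N : maximal_ideal M -> maximal_ideal N ->
  ~ (forall x, N x <-> M x) -> exists m n, [/\ M m, N n & m + n = 1].
Proof.
move=> maxM maxN neq; have [idealM nM1 Mmax] := maxM.
have [m Mm nNm] : exists2 m, M m & ~ N m.
  apply: NNPP => H; apply: neq.
  have sMN x : M x -> N x by move=> Mx; apply: NNPP => nNx; apply: H; exists x.
  have [idN nN1 _] := maxN.
  by move=> x; split; [apply: Mmax | apply: sMN].
have [r Nr] := maximal_ideal_comaximal maxN nNm; have [_ _ MM] := idealM.
by exists (r * m), (1 - r * m); split; [apply: MM | | ring].
Qed.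

(** The list may repeat entries or leave [U], so passing to unions and subfamilies needs no
    selection; ideals are compared pointwise, as in [finite_character]. *)
Definition finitely_many (U : (R -> Prop) -> Prop) :=
  exists n (Ms : 'I_n -> R -> Prop),
    forall M, U M -> exists i, forall x, M x <-> Ms i x.

Lemma finitely_many_union (U V W : (R -> Prop) -> Prop) :
  (forall M, U M -> V M \/ W M) ->
  finitely_many V -> finitely_many W -> finitely_many U.
Proof.
move=> UVW [n [Ms HV]] [k [Ns HW]]; exists (n + k)%N.
exists (fun i => match split i with inl j => Ms j | inr j => Ns j end).
move=> M /UVW[/HV|/HW] [i Hi].
- by exists (lshift k i) => x; rewrite (unsplitK (inl i : 'I_n + 'I_k)).
- by exists (rshift n i) => x; rewrite (unsplitK (inr i : 'I_n + 'I_k)).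
Qed.

Lemma infinitely_many_two (U : (R -> Prop) -> Prop) : ~ finitely_many U ->
  exists M N, [/\ U M, U N & ~ forall x, N x <-> M x].
Proof.
move=> infU; have [M UM] : exists M, U M.
  apply: NNPP => H; apply: infU; exists 0%N, (fun _ _ => False) => M UM.
  by case: H; exists M.
apply: NNPP => H; apply: infU; exists 1%N, (fun _ => M) => N UN.
by exists ord0; apply: NNPP => neq; apply: H; exists M, N.
Qed.

End Comaximality.

(** * Greedy choice of comaximal divisors *)

Section PrincipalOverEndomorphisms.
Variable R : idomainType.
Hypothesis fg_principal : forall I : R -> Prop,
  is_ideal I -> nonzero_ideal I -> fin_gen I ->
  exists2 x, IinK I x &
    set_eqK (IinK I) (fun y => exists2 e, endo I e & y = x * e).

(** For [g] in [I = (a, b, c)], write [g = x * e] with [e] in [E(I)]: then [g * g = x * (e * g)],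
    and [e * g] lies in [I], hence in [R]. *)
Lemma generator_divides_squares (a b c : R) : a != 0 ->
  exists x, [/\ exists u v w, x = u * a + v * b + w * c,
    divides x (a * a), divides x (b * b) & divides x (c * c)].
Proof.
move=> a0; pose I y := exists u v w, y = u * a + v * b + w * c.
have Ia : I a by exists 1, 0, 0; ring.
have Ib : I b by exists 0, 1, 0; ring.
have Ic : I c by exists 0, 0, 1; ring.
have idI : is_ideal I.
  split; first by exists 0, 0, 0; ring.
  - move=> _ _ [u [v [w ->]]] [u' [v' [w' ->]]].
    by exists (u + u'), (v + v'), (w + w'); ring.
  - move=> r _ [u [v [w ->]]].
    by exists (r * u), (r * v), (r * w); ring.
have fgI : fin_gen I.
  exists 3%N, (fun i => [:: a; b; c]`_i) => y; split.
    move=> [u [v [w ->]]]; exists (fun i => [:: u; v; w]`_i).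
    by rewrite !big_ord_recr big_ord0 /= add0r.
  move=> [k ->]; exists (k (inord 0)), (k (inord 1)), (k (inord 2)).
  rewrite !big_ord_recr big_ord0 /= add0r.
  by congr (k _ * _ + k _ * _ + k _ * _); apply: val_inj; rewrite /= inordK.
have [|_ [x Ix ->] HI] := fg_principal idI _ fgI; first by exists a.
have sqr g : I g -> divides x (g * g).
  move=> Ig; have [|e He Ee] := (HI (FracField.tofrac g)).1; first by exists g.
  have [|h Ih Eh] := He (FracField.tofrac g); first by exists g.
  exists h; apply/eqP; rewrite -tofrac_eq; apply/eqP.
  by rewrite !rmorphM /= {1}Ee -mulrA Eh mulrC.
by exists x; split; [| exact: sqr..].
Qed.

Definition maximal_avoiding (a p : R) (M : R -> Prop) :=
  [/\ maximal_ideal M, M a & ~ M p].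

Lemma infinitely_many_step (a p : R) :
  a != 0 -> ~ finitely_many (maximal_avoiding a p) ->
  exists x, [/\ divides x (a * a), ~ divides x 1, comaximal p x
    & ~ finitely_many (maximal_avoiding a (p * x))].
Proof.
move=> a0 infU.
have [M [N [[maxM Ma nMp] [maxN Na nNp] neq]]] := infinitely_many_two infU.
have [m [n [Mm Nn mn1]]] := maximal_ideals_separate maxM maxN neq.
(* Apply the previous lemma to [(a, b, 1 - r * p)], where [1 - r * p] lies in [L]. All three
   generators are in [L], so [x] is a nonunit; it divides the square of [1 - r * p], so it is
   comaximal with [p]. *)
have cand L b : maximal_avoiding a p L -> L b ->
    exists x, [/\ divides x (a * a), ~ divides x 1, comaximal p x
                & divides x (b * b)].
  move=> [maxL La nLp] Lb; have [r Lr] := maximal_ideal_comaximal maxL nLp.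
  have [x [[u [v [w xE]]] xa xb xr]] := generator_divides_squares b (1 - r * p) a0.
  have [[_ LD LM] nL1 _] := maxL.
  exists x; split=> //.
    move=> [s E]; apply: nL1; rewrite E; apply: (LM); rewrite xE.
    by apply: (LD); [apply: (LD) |]; apply: (LM).
  apply: (@comaximal_of_sqr _ (r * p) (1 - r * p)) => //; first by ring.
  by exists (r * r * p); ring.
have [|x [xa x1 px xm]] := cand M m _ Mm; first by split.
have [|y [ya y1 py yn]] := cand N n _ Nn; first by split.
have cxy := comaximal_of_sqr mn1 xm yn.
have [finx|] := classic (finitely_many (maximal_avoiding a (p * x)));
  last by exists x.
(* No maximal ideal contains both [x] and [y], so each one avoiding [p] also avoids [p * x] or
   [p * y]. *)
exists y; split=> // finy; apply: infU; apply: finitely_many_union finx finy.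
move=> L [maxL La nLp].
have [Lx|nLx] := classic (L x); [right | left]; split=> //.
  by apply: maximal_ideal_prime => //; apply: maximal_ideal_not_comaximal cxy Lx.
exact: maximal_ideal_prime.
Qed.

Lemma comaximal_divisor_sequence (a : R) : a != 0 ->
  ~ finitely_many (fun M => maximal_ideal M /\ M a) ->
  exists p x : nat -> R, [/\ p 0%N = 1, forall k, p k.+1 = p k * x k,
    forall k, divides (p k) (a * a), forall k, comaximal (p k) (x k)
    & forall k, ~ divides (x k) 1].
Proof.
move=> a0 infa.
pose P p := divides p (a * a) /\ ~ finitely_many (maximal_avoiding a p).
have P1 : P 1.
  split; first by exists (a * a); rewrite mulr1.
  (* A union of a family with itself transfers finiteness to a subfamily; here every maximal ideal
     avoids 1. *)
  move=> fin1; apply: infa; apply: finitely_many_union (fin1) (fin1).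
  by move=> M [maxM Ma]; left; split=> //; case: maxM.
have step (s : {p | P p}) :
    {x | [/\ P (sval s * x), comaximal (sval s) x & ~ divides x 1]}.
  apply: constructive_indefinite_description.
  case: s => p [pa infp] /=; have [x [xa x1 px infx]] := infinitely_many_step a0 infp.
  by exists x; split=> //; split=> //; apply: comaximal_dvd_mul.
(* The invariant [P] travels with the product, so that a choice is available at every stage. *)
pose next s : {p | P p} :=
  exist _ (sval s * sval (step s)) (let: And3 h _ _ := svalP (step s) in h).
pose s k := iter k next (exist _ 1 P1).
exists (fun k => sval (s k)), (fun k => sval (step (s k))); split=> // k.
- by case: (svalP (s k)).
- by case: (svalP (step (s k))).
- by case: (svalP (step (s k))).
Qed.

End PrincipalOverEndomorphisms.

(** * The union of the chain of ideals [(A / p k)] *)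

Section ChainIdeal.
Variables (R : idomainType) (A : R) (p x : nat -> R).
Hypotheses (A0 : A != 0) (p0 : p 0%N = 1) (pS : forall k, p k.+1 = p k * x k)
  (pA : forall k, divides (p k) A) (px : forall k, comaximal (p k) (x k)).

Local Notation "r %:F" := (@FracField.tofrac R r).

(* The union of the increasing chain of the ideals [(A / p k)]. *)
Definition chain_ideal (y : R) := exists k, divides A (y * p k).

Lemma chain_dvd k l : (k <= l)%N -> divides (p k) (p l).
Proof.
move=> /subnK <-; elim: (l - k)%N => [|d [r IH]]; first by exists 1; rewrite mul1r.
by exists (r * x (d + k)); rewrite addSn pS IH; ring.
Qed.

Lemma chain_ideal_mono y k l :
  (k <= l)%N -> divides A (y * p k) -> divides A (y * p l).
Proof. by move=> /chain_dvd[r ->] [s E]; exists (r * s); rewrite mulrCA E mulrA. Qed.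

Lemma chain_ideal_is_ideal : is_ideal chain_ideal.
Proof.
split.
- by exists 0%N, 0; rewrite !mul0r.
- move=> y z [k Hy] [l Hz]; exists (maxn k l).
  have [r Er] := chain_ideal_mono (leq_maxl k l) Hy.
  have [s Es] := chain_ideal_mono (leq_maxr k l) Hz.
  by exists (r + s); rewrite !mulrDl Er Es.
- by move=> r y [k [s E]]; exists k, (r * s); rewrite -mulrA E mulrA.
Qed.

Lemma chain_ideal_nonzero : nonzero_ideal chain_ideal.
Proof. by exists A => //; exists 0%N, 1; rewrite p0 mulrC. Qed.

(** If [M] contains [x k], it contains [p l] for all [l > k], hence no such [x l]. Past that index
    the successive [p l] differ by units of the localization, so the chain is stationary at [M]. *)
Lemma chain_quotient_avoids (M : R -> Prop) : maximal_ideal M ->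
  exists k, forall l, (k <= l)%N -> exists2 q, p l = q * p k & ~ M q.
Proof.
move=> maxM; have [_ M1 _] := maxM.
have from k : (forall l, (k <= l)%N -> ~ M (x l)) ->
    forall l, (k <= l)%N -> exists2 q, p l = q * p k & ~ M q.
  move=> Hk l /subnK <-; elim: (l - k)%N => [|d [q E Mq]].
    by exists 1; rewrite // mul1r.
  exists (q * x (d + k)); first by rewrite addSn pS E; ring.
  by apply: maximal_ideal_prime => //; apply: Hk; rewrite leq_addl.
have [[k Mk]|H] := classic (exists k, M (x k)); last first.
  by exists 0%N; apply: from => l _ Ml; apply: H; exists l.
exists k.+1; apply: from => l /chain_dvd[r E].
apply: maximal_ideal_not_comaximal (px l) _ => //.
have [[_ _ MM] _ _] := maxM.
by rewrite E pS mulrA; apply: MM.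
Qed.

Lemma localization_denominator_neq0 (M : R -> Prop) s :
  maximal_ideal M -> ~ M s -> s%:F != 0.
Proof.
move=> [[M0 _ _] _ _] Ms; rewrite tofrac_eq0.
by apply/eqP => E; rewrite E in Ms.
Qed.

Lemma localization_sum (M : R -> Prop) n (b : 'I_n -> {fraction R}) :
  maximal_ideal M -> (forall i, localization M (b i)) ->
  localization M (\sum_(i < n) b i).
Proof.
move=> maxM Hb; have [_ M1 _] := maxM.
apply: (big_ind (localization M)) => //.
  by exists 0, 1; split=> //; rewrite rmorph0 mul0r.
move=> _ _ [u [s [Ms ->]]] [v [t [Mt ->]]].
exists (u * t + v * s), (s * t); split; first exact: maximal_ideal_prime.
have s0 := localization_denominator_neq0 maxM Ms.
have t0 := localization_denominator_neq0 maxM Mt.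
by rewrite rmorphD !rmorphM /= addf_div.
Qed.

Lemma chain_ideal_locally_principal : locally_principal chain_ideal.
Proof.
move=> M maxM.
have [k Hk] := chain_quotient_avoids maxM; have [B EB] := pA k.
have pk0 : p k != 0 by apply: contraNneq A0 => E; rewrite EB E mulr0.
have JB : chain_ideal B by exists k, 1; rewrite mul1r EB.
exists B%:F => z; split; last first.
  move=> [r Mr ->]; exists 1%N, (fun _ => B%:F), (fun _ => r); split=> //.
    by exists B.
  by rewrite big_ord1.
move=> [n [a [b [Ja Mb ->]]]].
suff H i : exists2 c, localization M c & a i * b i = B%:F * c.
  have {}H i : {c | localization M c /\ a i * b i = B%:F * c}.
    by apply: constructive_indefinite_description; have [c] := H i; exists c.
  exists (\sum_(i < n) sval (H i)).
    by apply: localization_sum => // i; case: (svalP (H i)).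
  by rewrite mulr_sumr; apply: eq_bigr => i _; case: (svalP (H i)).
(* At the index [maxn k l], the element [y] satisfies [y * q = r * B] with [q] outside [M], so [y]
   is a multiple of [B] in the localization. *)
have [y [l Hl] Ey] := Ja i; have [u [s [Ms Eb]]] := Mb i.
have [r Er] := chain_ideal_mono (leq_maxr k l) Hl.
have [q Eq Mq] := Hk _ (leq_maxl k l).
have q0 := localization_denominator_neq0 maxM Mq.
have yq : y * q = r * B.
  by apply: (mulIf pk0); rewrite -!mulrA -Eq -EB.
exists ((r * u)%:F / (q * s)%:F).
  by exists (r * u), (q * s); split=> //; apply: maximal_ideal_prime.
have -> : a i = (r * B)%:F / q%:F by rewrite Ey -yq rmorphM /= mulfK.
by rewrite Eb !rmorphM /= invfM; ring.
Qed.

Lemma chain_ideal_invertible_unit :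
  invertible chain_ideal -> exists k, divides (x k) 1.
Proof.
move=> inv; have [|n [a [b [Ja Jb E1]]]] := (inv 1).2.
  by exists 1; rewrite rmorph1.
(* The finitely many [a i] in [1 = \sum_i a i * b i] all lie in one member [(A / p l)] of the
   chain. *)
have [l Hl] : exists l, forall i, exists r, a i * (p l)%:F = r%:F * A%:F.
  have {}Ja i : {k | exists r, a i * (p k)%:F = r%:F * A%:F}.
    apply: constructive_indefinite_description.
    have [y [k [r E]] ->] := Ja i.
    by exists k, r; rewrite -!rmorphM /= E.
  exists (\max_(i < n) sval (Ja i)) => i.
  have [s ->] := chain_dvd (leq_bigmax (F := fun i => sval (Ja i)) i).
  have [r E] := svalP (Ja i).
  by exists (s * r); rewrite !rmorphM /= mulrCA E mulrA.
(* Compare with the next member, generated by [C = A / p l.+1]: each [b i * C] is in [R], so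
   [C * p l], the sum of the [(a i * p l) * (b i * C)], is a multiple of [A = C * p l * x l].
   Cancelling [C * p l] makes [x l] a unit. *)
have [C EC] := pA l.+1.
have JC : chain_ideal C by exists l.+1, 1; rewrite mul1r EC.
have [r Er] : exists r, (C * p l)%:F = r%:F * A%:F.
  have H i : {r | a i * b i * (C * p l)%:F = r%:F * A%:F}.
    apply: constructive_indefinite_description.
    have [|v Ev] := Jb i C%:F; first by exists C.
    have [u Eu] := Hl i.
    exists (u * v); rewrite !rmorphM /=.
    have -> : a i * b i * (C%:F * (p l)%:F) = (a i * (p l)%:F) * (b i * C%:F) by ring.
    by rewrite Eu Ev; ring.
  exists (\sum_(i < n) sval (H i)).
  rewrite rmorph_sum /= mulr_suml -[LHS]mul1r E1 mulr_suml.
  by apply: eq_bigr => i _; case: (svalP (H i)).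
have {}Er : C * p l = r * A.
  by apply/eqP; rewrite -tofrac_eq; apply/eqP; rewrite [RHS]rmorphM.
exists l, r; have Cp0 : C * p l != 0.
  by apply: contraNneq A0 => E; rewrite EC pS mulrA E mul0r.
by apply: (mulIf Cp0); rewrite mul1r {1}Er EC pS; ring.
Qed.

End ChainIdeal.

Theorem theorem12 (R : idomainType) :
  (exists y : {fraction R}, ~ RinK y) ->
  finitely_stable R ->
  LPI_domain R ->
  (forall I : R -> Prop, is_ideal I -> nonzero_ideal I -> fin_gen I ->
     exists2 x, IinK I x &
       set_eqK (IinK I) (fun y => exists2 e, endo I e & y = x * e)) ->
  finite_character R.
Proof.
move=> _ _ lpi fg_principal a a0; apply: NNPP => infa.
have [|p [x [p0 pS pA px x1]]] := comaximal_divisor_sequence fg_principal a0.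
  by move=> [n [Ms fin]]; apply: infa; exists n, Ms => M maxM Ma; apply: fin.
have A0 : a * a != 0 by rewrite mulf_neq0.
have [k /x1[]] := chain_ideal_invertible_unit A0 pS pA
  (lpi _ (chain_ideal_is_ideal _ pS) (chain_ideal_nonzero A0 p0)
     (chain_ideal_locally_principal A0 pS pA px)).
Qed.
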